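(* Let $c\ge 3$ be an integer. For $2\le i\le c-1$ put $$A_i=\sum_{d_1=0}^{i-2}\ \sum_{\substack{0\le d_2\le c-i-1 \\ c+d_1+d_2\equiv 1 \ (\mathrm{mod}\ 3)}}\binom{i-2}{d_1}\,\delta(\{i\})\,\binom{c-i-1}{d_2}\;+\;\sum_{d_1=0}^{i-2}\ \sum_{\substack{0\le d_2\le c-i-1 \\ c+d_1+1+d_2\equiv 1\ (\mathrm{mod}\ 3)}}\binom{i-2}{d_1}\,\delta(\{i,i+1\})\,\binom{c-i-1}{d_2},$$ so that the following lower bound for the average genus of a 2-bridge knot with crossing number $c$ holds: $\frac{c-1}{2}-\frac{3}{2(2^{c-2}+* )}\sum_{i=2}^{c-1}A_i$. Then in this bound, for even $c$, the summation over $i$ need only go to $\frac c2$ with the total doubled, i.e. $$\sum_{i=2}^{c-1}A_i = 2\sum_{i=2}^{c/2}A_i ;$$ and for odd $c$ one may count doubly for $i$ up to $\lfloor \frac c2\rfloor$ and count singly $i=\lceil \frac c2\rceil$, i.e. $$\sum_{i=2}^{c-1}A_i = 2\sum_{i=2}^{\lfloor c/2\rfloor}A_i + A_{\lceil c/2\rceil}.$$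
   Context: For given $i$ and $d_1$: $\delta(\{i\})=0$ if $i+d_1\equiv 1\bmod 3$ and $\delta(\{i\})=1$ otherwise; $\delta(\{i,i+1\})=0$ if $i+d_1\equiv 2\bmod 3$ and $\delta(\{i,i+1\})=1$ otherwise. The number $*$ is $2\cos\frac{(c-2)\pi}{3}$ if $c\equiv1$, $2\cos\frac{(c-4)\pi}{3}$ if $c\equiv0$, and $2\cos\frac{(c-6)\pi}{3}$ if $c\equiv2\bmod 3$. The average genus is taken over all 2-bridge knots of crossing number $c$, each appearing twice except those of palindromic type, which appear once; the displayed bound is a previously established result and is recalled only to identify the summation, and the content of the claim is the two identities for $\sum_{i=2}^{c-1}A_i$. Empty sums are $0$. Palindromic type refers to the words $(+)^{\varepsilon_1}(-)^{\varepsilon_2}(+)^{\varepsilon_3}\cdots$ with $c$ runs, $\varepsilon_1=\varepsilon_c=1$, $\varepsilon_i\in\{1,2\}$ and $\sum\varepsilon_i\equiv1\bmod3$ that encode these knots: for $c$ odd, words equal to their reverse; for $c$ even, words equal to the reverse of their mirror image (the mirror image exchanges $+$ and $-$). *)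

(* Defs.v *)
From mathcomp Require Import all_boot.

Set Implicit Arguments.
Unset Strict Implicit.
Unset Printing Implicit Defensive.

(* delta({i}) for a given d1 *)
Definition delta_single (i d1 : nat) : nat :=
  if i + d1 == 1 %[mod 3] then 0 else 1.

(* delta({i, i+1}) for a given d1 *)
Definition delta_double (i d1 : nat) : nat :=
  if i + d1 == 2 %[mod 3] then 0 else 1.

(* A c i is the summand A_i; it is meaningful for 2 <= i <= c - 1, where the
   natural-number subtractions i - 2 and c - i - 1 do not truncate. *)
Definition A (c i : nat) : nat :=
  \sum_(0 <= d1 < (i - 2).+1)
    \sum_(0 <= d2 < (c - i - 1).+1 | c + d1 + d2 == 1 %[mod 3])
      'C(i - 2, d1) * delta_single i d1 * 'C(c - i - 1, d2)
  + \sum_(0 <= d1 < (i - 2).+1)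
    \sum_(0 <= d2 < (c - i - 1).+1 | c + d1 + 1 + d2 == 1 %[mod 3])
      'C(i - 2, d1) * delta_double i d1 * 'C(c - i - 1, d2).

(* Main.v *)
Require Import Defs.
From mathcomp Require Import all_boot.
From mathcomp Require Import zify.

(** The summands are symmetric under the reflection [i <-> c + 1 - i]
    ([A_reflect]), and this reflection maps the range [2, c - 1] to itself,
    exchanging its two halves and fixing the middle index when [c] is odd
    ([sum_upper_half]).

    For the symmetry, put [a = i - 2] and [b = c - i - 1]; the reflection
    exchanges [a] and [b].  Then [c = a + b + 3], so with [x = a + d1] and
    [y = b + d2] the first sum runs over [x + y = 1 (mod 3)] and its delta
    excludes [x = 2], while the second runs over [x + y = 0 (mod 3)] and
    excludes [x = 0].  In both cases the excluded residue is the one that is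
    its own partner: [x = 2] iff [y = 2] in the first sum, [x = 0] iff [y = 0]
    in the second.  Exchanging the order of summation therefore matches the
    terms [(d1, d2)] for [i] with the terms [(d2, d1)] for [c + 1 - i]. *)

Lemma exchange_sum_swap (m n : nat) (P P' : nat -> nat -> bool)
    (F F' : nat -> nat -> nat) :
    (forall x y, P x y = P' y x) ->
    (forall x y, P x y -> F x y = F' y x) ->
  \sum_(0 <= x < m) \sum_(0 <= y < n | P x y) F x y =
  \sum_(0 <= y < n) \sum_(0 <= x < m | P' y x) F' y x.
Proof.
move=> PP' FF'; rewrite (exchange_big_dep xpredT) //=.
by apply: eq_bigr => y _; apply: eq_big => [x | x /FF'].
Qed.

(** With [x = i - 2 + d1] and [y = c - i - 1 + d2], the congruence says
    [x + y = 1 (mod 3)], and the two deltas vanish at [x = 2] and [y = 2]: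
    equivalent conditions since [2 + 2 = 1 (mod 3)]. *)
Lemma delta_single_swap (c i d1 d2 : nat) :
    2 <= i < c -> c + d1 + d2 == 1 %[mod 3] ->
  delta_single i d1 = delta_single (c.+1 - i) d2.
Proof.
rewrite /delta_single => ? ?.
suff -> : (i + d1 == 1 %[mod 3]) = (c.+1 - i + d2 == 1 %[mod 3]) by [].
lia.
Qed.

(** With the same [x] and [y], now [x + y = 0 (mod 3)], and the two deltas
    vanish at [x = 0] and [y = 0]. *)
Lemma delta_double_swap (c i d1 d2 : nat) :
    2 <= i < c -> c + d1 + 1 + d2 == 1 %[mod 3] ->
  delta_double i d1 = delta_double (c.+1 - i) d2.
Proof.
rewrite /delta_double => ? ?.
suff -> : (i + d1 == 2 %[mod 3]) = (c.+1 - i + d2 == 2 %[mod 3]) by [].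
lia.
Qed.

Lemma A_reflect (c i : nat) : 2 <= i < c -> A c i = A c (c.+1 - i).
Proof.
move=> ic; rewrite /A.
have -> : c.+1 - i - 2 = c - i - 1 by lia.
have -> : c - (c.+1 - i) - 1 = i - 2 by lia.
congr (_ + _); apply: exchange_sum_swap => d1 d2.
- by rewrite addnAC.
- by move=> /(delta_single_swap _ _ _ _ ic) ->; rewrite mulnC mulnA mulnAC.
- by congr (_ == _ %[mod 3]); lia.
- by move=> /(delta_double_swap _ _ _ _ ic) ->; rewrite mulnC mulnA mulnAC.
Qed.

Lemma sum_upper_half (c h : nat) (F : nat -> nat) :
    h < c -> (forall i, 2 <= i < c -> F i = F (c.+1 - i)) ->
  \sum_(c.+1 - h <= i < c) F i = \sum_(2 <= i < h.+1) F i.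
Proof.
move=> hc Frefl; rewrite big_nat_rev -[c.+1 - h]add0n big_addn.
rewrite -[in RHS](add0n 2) big_addn.
have -> : c - (c.+1 - h) = h.+1 - 2 by lia.
rewrite [LHS]big_nat [RHS]big_nat; apply: eq_bigr => j jh.
rewrite [RHS]Frefl; last by lia.
by congr F; lia.
Qed.

Theorem corollary4p4 (c : nat) (hc : 3 <= c) :
  (~~ odd c ->
     \sum_(2 <= i < c) A c i = 2 * \sum_(2 <= i < (c./2).+1) A c i) /\
  (odd c ->
     \sum_(2 <= i < c) A c i =
       2 * (\sum_(2 <= i < (c./2).+1) A c i) + A c (uphalf c)).
Proof.
have upper := sum_upper_half c c./2 (A c) ltac:(lia) (A_reflect c).
split=> oddc; rewrite (@big_cat_nat _ _ _ (c./2).+1) /=; try lia.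
- have eq_mid : (c./2).+1 = c.+1 - c./2 by lia.
  by rewrite [in X in _ + X]eq_mid upper mul2n addnn.
- rewrite [in X in _ + X]big_ltn; last by lia.
  have -> : (c./2).+2 = c.+1 - c./2 by lia.
  have -> : uphalf c = (c./2).+1 by lia.
  by rewrite upper mul2n -addnn addnCA addnC addnAC addnA.
Qed.
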